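(* Let $\mathbf{k}$ be an algebraically closed field of characteristic $0$, $A$ a finite-dimensional associative $\mathbf{k}$-algebra, and $eAe$ a basic algebra associated with $A$ as in the context. Then: (a) If $\phi$ is a symmetric linear function on $A$, then $(\phi_{{}_AAe})_{Ae_{eAe}}(a)=\phi(a)$ for all $a\in A$. (b) If $\psi$ is a symmetric linear function on $eAe$, then $(\psi_{Ae_{eAe}})_{{}_AAe}(eae)=\psi(eae)$ for all $eae\in eAe$. (c) The space of symmetric linear functions on $A$ and the space of symmetric linear functions on $eAe$ are isomorphic as vector spaces.
   Context: A linear function $\phi$ on an algebra $B$ is symmetric if $\phi(ab)=\phi(ba)$ for all $a,b\in B$; $\mathrm{SLF}(B)$ denotes the space of these. Basic algebra: let $1=\sum_{i=1}^n\sum_{j=1}^{n_i}e_{ij}$ be a decomposition of the unity of $A$ into mutually orthogonal primitive idempotents with $e_{ij}A\cong e_{ik}A$ for all $j,k$ and $e_{ij}A\not\cong e_{k\ell}A$ for $i\neq k$. Set $e_i=e_{i1}$ and $e=\sum_{i=1}^ne_i$. The algebra $eAe$ with unity $e$ is the basic algebra associated with $A$, and $Ae$ is an $(A,eAe)$-bimodule, finitely generated projective both as a left $A$-module ${}_AAe$ and as a right $eAe$-module $Ae_{eAe}$. For an algebra $B$, a finitely generated projective right $B$-module $V$ and $\psi\in\mathrm{SLF}(B)$, define $\psi_V\in\mathrm{SLF}(\mathrm{End}_B(V))$ by $\psi_V(\beta)=\psi(\sum_i\alpha_i(\beta(u_i)))$, where $u_i\in V$, $\alpha_i\in\mathrm{Hom}_B(V,B)$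 are finitely many elements with $v=\sum_iu_i\alpha_i(v)$ for all $v\in V$ (independent of choices). For left modules the definition is the same with $v=\sum_i\alpha_i(v)u_i$. Identifications: the map $\ell:A\to\mathrm{End}_{eAe}(Ae_{eAe})$, $\ell(a)(be)=abe$, is an algebra isomorphism, and $r:eAe\to\mathrm{End}_A({}_AAe)$, $r(eae)(be)=beae$, is an algebra anti-isomorphism. Via $\ell$ and $r$ (and $\mathrm{SLF}(eAe)=\mathrm{SLF}((eAe)^{\mathrm{op}})$) one obtains linear maps $(-)_{Ae_{eAe}}:\mathrm{SLF}(eAe)\to\mathrm{SLF}(A)$, $\psi_{Ae_{eAe}}(a):=\psi_{Ae_{eAe}}(\ell(a))$, and $(-)_{{}_AAe}:\mathrm{SLF}(A)\to\mathrm{SLF}(eAe)$, $\phi_{{}_AAe}(eae):=\phi_{{}_AAe}(r(eae))$. *)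

(* Defs.v *)
From HB Require Import structures.
From mathcomp Require Import all_boot all_algebra all_field.
From mathcomp Require Import boolp classical_sets.

Set Implicit Arguments.
Unset Strict Implicit.
Unset Printing Implicit Defensive.

Import GRing.Theory.
Local Open Scope ring_scope.

Section SymmetricLinearFunctions.
Variables (K : fieldType) (B : falgType K).

Definition symmetric_fun (f : B -> K) : Prop := forall a b, f (a * b) = f (b * a).

Definition slf_pred : {pred 'Hom(B, K^o)} := fun f => `[< symmetric_fun f >].

Fact slf_submod_closed : submod_closed slf_pred.
Proof.
split; first by apply/asboolP => a b; rewrite !lfunE.
move=> c f g /asboolP sf /asboolP sg; apply/asboolP => a b.
by rewrite !lfunE /= !lfunE /= sf sg.
Qed.

HB.instance Definition _ :=
  GRing.isSubmodClosed.Build K 'Hom(B, K^o) slf_pred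
    slf_submod_closed.

Record SLF : Type := MkSLF { slf_hom :> 'Hom(B, K^o); _ : slf_hom \in slf_pred }.

HB.instance Definition _ := [isSub for slf_hom].
HB.instance Definition _ := [Choice of SLF by <:].
HB.instance Definition _ := [SubChoice_isSubLmodule of SLF by <:].

Lemma slfC (f : SLF) : symmetric_fun f.
Proof. by case: f => f /= /asboolP. Qed.

Definition mk_slf (f : {linear B -> K^o}) (sf : symmetric_fun f) : SLF.
Proof. by exists (linfun f); apply/asboolP => a b; rewrite !lfunE /= sf. Defined.

Lemma mk_slfE f sf a : @mk_slf f sf a = f a.
Proof. by rewrite lfunE. Qed.

End SymmetricLinearFunctions.

(* Modules in the library are left modules: a right B-module is an lmodType
   over the converse ring B^c, where b *: v stands for v b.  Since
   SLF(B) = SLF(B^c), the two sides share the definition of psi_V. *)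
Section TraceOnEndomorphisms.
Variables (R : nzRingType) (V : lmodType R).

Record dual_basis : Type := DualBasis {
  db_size : nat;
  db_vec : 'I_db_size -> V;
  db_form : 'I_db_size -> {linear V -> R^o};
  db_eq : forall v, v = \sum_i db_form i v *: db_vec i }.

Definition fg_projective : Prop := $| dual_basis |.

Arguments db_vec : clear implicits.
Arguments db_form : clear implicits.

Variables (K : zmodType).

Definition trace_of (D : dual_basis) (psi : R -> K) (beta : V -> V) : K :=
  psi (\sum_i db_form D i (beta (db_vec D i))).

(* The dual basis is chosen classically; module_traceE shows that the choice is
   immaterial when psi is symmetric and beta is R-linear. *)
Definition module_trace (hV : fg_projective) : (R -> K) -> (V -> V) -> K :=
  trace_of (unsquash hV).

Variable psi : {additive R -> K}.
Hypothesis psiC : forall a b, psi (a * b) = psi (b * a).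

Lemma trace_of_swap (D D' : dual_basis) (beta gamma : {linear V -> V}) :
  trace_of D psi (fun v => beta (gamma v)) =
  trace_of D' psi (fun v => gamma (beta v)).
Proof.
rewrite /trace_of.
transitivity (\sum_i \sum_j
    psi (db_form D' j (gamma (db_vec D i)) * db_form D i (beta (db_vec D' j)))).
  rewrite raddf_sum; apply: eq_bigr => i _.
  rewrite [gamma _ in LHS](db_eq D') !linear_sum /= raddf_sum.
  by apply: eq_bigr => j _; rewrite !linearZ /=.
rewrite exchange_big /= raddf_sum; apply: eq_bigr => j _.
rewrite [beta (db_vec D' j) in RHS](db_eq D) !linear_sum /= raddf_sum.
by apply: eq_bigr => i _; rewrite psiC !linearZ /=.
Qed.

Lemma trace_of_indep (D D' : dual_basis) (beta : {linear V -> V}) :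
  trace_of D psi beta = trace_of D' psi beta.
Proof. exact: (trace_of_swap D D' beta idfun). Qed.

Lemma module_traceE (hV : fg_projective) (D : dual_basis)
  (beta : {linear V -> V}) : module_trace hV psi beta = trace_of D psi beta.
Proof. exact: trace_of_indep. Qed.

Lemma module_traceC (hV : fg_projective) (beta gamma : {linear V -> V}) :
  module_trace hV psi (fun v => beta (gamma v)) =
  module_trace hV psi (fun v => gamma (beta v)).
Proof. exact: trace_of_swap. Qed.

End TraceOnEndomorphisms.

Arguments db_vec {R V} _ _.
Arguments db_form {R V} _ _.

Section Ideals.
Variables (K : fieldType) (A : falgType K).

Definition right_ideal (u : A) : {vspace A} := limg (amull u).
Definition left_ideal (u : A) : {vspace A} := limg (amulr u).
Definition corner (u : A) : {vspace A} := limg (amulr u \o amull u)%VF.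

Lemma right_idealP u v :
  reflect (exists b, v = u * b) (v \in right_ideal u).
Proof.
apply: (iffP memv_imgP) => [[b _ ->]|[b ->]]; exists b; rewrite ?memvf ?lfunE //.
Qed.

Lemma left_idealP u v :
  reflect (exists b, v = b * u) (v \in left_ideal u).
Proof.
apply: (iffP memv_imgP) => [[b _ ->]|[b ->]]; exists b; rewrite ?memvf ?lfunE //.
Qed.

Lemma cornerP u v :
  reflect (exists b, v = u * b * u) (v \in corner u).
Proof.
apply: (iffP memv_imgP) => [[b _ ->]|[b ->]]; exists b;
  by rewrite ?memvf ?lfunE //= !lfunE.
Qed.

Definition right_ideal_mod (u : A) : Type := subvs_of (right_ideal u).

Section RightIdealModule.
Variable u : A.
Notation M := (right_ideal_mod u).
HB.instance Definition _ := GRing.Zmodule.on M.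

Fact rideal_act_subproof (a : A^c) (v : M) : vsval v * (a : A) \in right_ideal u.
Proof.
have /right_idealP[b ->] := subvsP v.
by apply/right_idealP; exists (b * a); rewrite mulrA.
Qed.
Definition rideal_act (a : A^c) (v : M) : M := Subvs (rideal_act_subproof a v).

Fact rideal_actA a b v : rideal_act a (rideal_act b v) = rideal_act (a * b) v.
Proof. by apply: val_inj; rewrite /= -mulrA. Qed.
Fact rideal_act1 : left_id 1 rideal_act.
Proof. by move=> v; apply: val_inj; rewrite /= mulr1. Qed.
Fact rideal_actDr : right_distributive rideal_act +%R.
Proof. by move=> a v w; apply: val_inj; rewrite /= mulrDl. Qed.
Fact rideal_actDl v : {morph rideal_act^~ v : a b / a + b}.
Proof. by move=> a b; apply: val_inj; rewrite /= mulrDr. Qed.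

HB.instance Definition _ := GRing.Zmodule_isLmodule.Build A^c M
  rideal_actA rideal_act1 rideal_actDr rideal_actDl.
End RightIdealModule.

Definition right_ideal_iso (u v : A) : Prop :=
  exists f : {linear right_ideal_mod u -> right_ideal_mod v}, bijective f.

Definition primitive_idempotent (f : A) : Prop :=
  [/\ f != 0, f * f = f &
      forall g h : A, g * g = g -> h * h = h -> g * h = 0 -> h * g = 0 ->
        f = g + h -> g = 0 \/ h = 0].

(* The multiplicity n_i is (bd_mult i).+1, and e_{i1} is bd_idem i ord0. *)
Record basic_decomp : Type := BasicDecomp {
  bd_size : nat;
  bd_mult : 'I_bd_size -> nat;
  bd_idem : forall i, 'I_(bd_mult i).+1 -> A;
  bd_primitive : forall i j, primitive_idempotent (@bd_idem i j);
  bd_orthogonal : forall p q : {i : 'I_bd_size & 'I_(bd_mult i).+1},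
    p != q -> bd_idem (tagged p) * bd_idem (tagged q) = 0;
  bd_sum : \sum_i \sum_j @bd_idem i j = 1;
  bd_iso : forall i j k, right_ideal_iso (@bd_idem i j) (@bd_idem i k);
  bd_niso : forall i k j l, i != k ->
    ~ right_ideal_iso (@bd_idem i j) (@bd_idem k l) }.

End Ideals.

Arguments bd_mult {K A} _ _.
Arguments bd_idem {K A} _ {i} _.

Section BasicAlgebra.
Variables (K : fieldType) (A : falgType K) (d : basic_decomp A).

Definition basic_idem : A := \sum_i bd_idem d (ord0 : 'I_(bd_mult d i).+1).
Notation e := basic_idem.

Lemma basic_idemMl i (j := ord0 : 'I_(bd_mult d i).+1) :
  e * bd_idem d j = bd_idem d j.
Proof.
rewrite /basic_idem mulr_suml (bigD1 i) //= big1 ?addr0 => [|k ki].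
  by have [] := bd_primitive j.
apply: (@bd_orthogonal _ _ d (existT _ k ord0) (existT _ i ord0)).
by apply: contra ki => /eqP [->].
Qed.

Lemma basic_idemMr i (j := ord0 : 'I_(bd_mult d i).+1) :
  bd_idem d j * e = bd_idem d j.
Proof.
rewrite /basic_idem mulr_sumr (bigD1 i) //= big1 ?addr0 => [|k ki].
  by have [] := bd_primitive j.
apply: (@bd_orthogonal _ _ d (existT _ i ord0) (existT _ k ord0)).
by apply: contra ki => /eqP [->].
Qed.

Lemma basic_idemK : e * e = e.
Proof. by rewrite {2}/basic_idem mulr_sumr; apply: eq_bigr => i _; rewrite basic_idemMl. Qed.

Lemma basic_idem_neq0 : e != 0.
Proof.
apply/eqP => e0; have /eqP := oner_neq0 A; apply.
rewrite -(bd_sum d) big1 // => i _.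
have [/eqP nz _ _] := bd_primitive (ord0 : 'I_(bd_mult d i).+1).
by case: nz; rewrite -basic_idemMl e0 mul0r.
Qed.

Fact corner_algid : is_algid e (corner e).
Proof.
split; first by apply/cornerP; exists e; rewrite !basic_idemK.
  exact: basic_idem_neq0.
move=> u /cornerP[b ->]; split; first by rewrite !mulrA basic_idemK.
by rewrite -!mulrA basic_idemK.
Qed.

Fact corner_is_aspace : is_aspace (corner e).
Proof.
apply/andP; split; first by apply/has_algidP; exists e; apply: corner_algid.
apply/prodvP => u v /cornerP[b ->] /cornerP[c ->].
by apply/cornerP; exists (b * e * e * c); rewrite !mulrA.
Qed.

Definition corner_aspace : {aspace A} := ASpace corner_is_aspace.
Definition eAe : falgType K := subvs_of corner_aspace.

Lemma eAe_memP (x : eAe) : exists b, vsval x = e * b * e.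
Proof. by apply/cornerP; apply: (subvsP x). Qed.

Lemma eAe_one : vsval (1 : eAe) = e.
Proof.
have [ie _ eU] := corner_algid.
rewrite -[LHS]/(algid corner_aspace).
by rewrite -[RHS](@algidl _ _ corner_aspace e ie) (eU _ (memv_algid corner_aspace)).2.
Qed.

Lemma eAe_mul (x y : eAe) : vsval (x * y) = vsval x * vsval y.
Proof. by []. Qed.

Definition Ae_left : Type := subvs_of (left_ideal e).
HB.instance Definition _ := GRing.Zmodule.on Ae_left.

Fact Ael_act_subproof (a : A) (v : Ae_left) : a * vsval v \in left_ideal e.
Proof.
have /left_idealP[b ->] := subvsP v.
by apply/left_idealP; exists (a * b); rewrite mulrA.
Qed.
Definition Ael_act a v : Ae_left := Subvs (Ael_act_subproof a v).

Fact Ael_actA a b v : Ael_act a (Ael_act b v) = Ael_act (a * b) v.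
Proof. by apply: val_inj; rewrite /= mulrA. Qed.
Fact Ael_act1 : left_id 1 Ael_act.
Proof. by move=> v; apply: val_inj; rewrite /= mul1r. Qed.
Fact Ael_actDr : right_distributive Ael_act +%R.
Proof. by move=> a v w; apply: val_inj; rewrite /= mulrDr. Qed.
Fact Ael_actDl v : {morph Ael_act^~ v : a b / a + b}.
Proof. by move=> a b; apply: val_inj; rewrite /= mulrDl. Qed.

HB.instance Definition _ := GRing.Zmodule_isLmodule.Build A Ae_left
  Ael_actA Ael_act1 Ael_actDr Ael_actDl.

Definition Ae_right : Type := subvs_of (left_ideal e).
HB.instance Definition _ := GRing.Zmodule.on Ae_right.

Lemma Ae_mule (v : subvs_of (left_ideal e)) : vsval v * e = vsval v.
Proof. by have /left_idealP[b ->] := subvsP v; rewrite -mulrA basic_idemK. Qed.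

Lemma mul_Ae_eAe_subproof (v : subvs_of (left_ideal e)) (x : eAe) :
  vsval v * vsval x \in left_ideal e.
Proof.
have [b ->] := eAe_memP x.
by apply/left_idealP; exists (vsval v * (e * b)); rewrite !mulrA.
Qed.

Definition Aer_act (x : eAe^c) (v : Ae_right) : Ae_right :=
  Subvs (mul_Ae_eAe_subproof v x).

Fact Aer_actA a b v : Aer_act a (Aer_act b v) = Aer_act (a * b) v.
Proof. by apply: val_inj; rewrite /= -mulrA. Qed.
Fact Aer_act1 : left_id 1 Aer_act.
Proof. by move=> v; apply: val_inj; rewrite -[RHS]Ae_mule; congr (_ * _); exact: eAe_one. Qed.
Fact Aer_actDr : right_distributive Aer_act +%R.
Proof. by move=> a v w; apply: val_inj; rewrite /= mulrDl. Qed.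
Fact Aer_actDl v : {morph Aer_act^~ v : a b / a + b}.
Proof. by move=> a b; apply: val_inj; rewrite /= mulrDr. Qed.

HB.instance Definition _ := GRing.Zmodule_isLmodule.Build eAe^c Ae_right
  Aer_actA Aer_act1 Aer_actDr Aer_actDl.

Definition Ael_form : Ae_left -> A^o := vsval.
Fact Ael_form_is_linear : linear Ael_form.
Proof. by []. Qed.
HB.instance Definition _ :=
  GRing.isLinear.Build A Ae_left A^o *:%R Ael_form Ael_form_is_linear.

Lemma Ae_left_fg_projective : fg_projective Ae_left.
Proof.
have Ee : e \in left_ideal e by apply/left_idealP; exists 1; rewrite mul1r.
apply: squash.
apply: (@DualBasis _ _ 1 (fun=> (Subvs Ee : Ae_left)) (fun=> Ael_form)) => v.
by rewrite big_ord1; apply: val_inj; rewrite /= Ae_mule.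
Qed.

Lemma bd_factor i (j : 'I_(bd_mult d i).+1) :
  exists yx : A * A, yx.1 * e * yx.2 = bd_idem d j.
Proof.
have [f [g fK gK]] := @bd_iso _ _ d i ord0 j.
have idk k : bd_idem d k \in right_ideal (bd_idem d (k : 'I_(bd_mult d i).+1)).
  by apply/right_idealP; exists 1; rewrite mulr1.
pose u : right_ideal_mod _ := Subvs (idk ord0).
pose w : right_ideal_mod _ := Subvs (idk j).
exists (vsval (f u), vsval (g w)) => /=.
have [b gwE] := right_idealP _ _ (subvsP (g w)).
have [_ uu _] := bd_primitive (ord0 : 'I_(bd_mult d i).+1).
have egw : e * vsval (g w) = vsval (g w) by rewrite gwE mulrA basic_idemMl.
rewrite -mulrA egw.
have -> : vsval (f u) * vsval (g w) = vsval (f ((vsval (g w) : A^c) *: u)).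
  by rewrite linearZ.
have -> : (vsval (g w) : A^c) *: u = g w.
  by apply: val_inj; rewrite /= gwE mulrA uu.
by rewrite gK.
Qed.

Fact Aer_form_subproof (x : A) (v : Ae_right) : e * x * vsval v \in corner e.
Proof. by apply/cornerP; exists (x * vsval v); rewrite -(Ae_mule v) !mulrA -[_ * e * e]mulrA basic_idemK. Qed.
Definition Aer_form (x : A) (v : Ae_right) : (eAe^c)^o :=
  (Subvs (Aer_form_subproof x v) : subvs_of corner_aspace).
Fact Aer_form_is_linear x : linear (Aer_form x).
Proof.
by move=> a u v; apply: val_inj; rewrite /= mulrDr mulrA.
Qed.
HB.instance Definition _ x :=
  GRing.isLinear.Build eAe^c Ae_right (eAe^c)^o *:%R (Aer_form x)
    (Aer_form_is_linear x).

Lemma Ae_right_fg_projective : fg_projective Ae_right.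
Proof.
pose T : finType := {i : 'I_(bd_size d) & 'I_(bd_mult d i).+1}.
have /choice[yx yxE] : forall p : T, exists yx : A * A,
    yx.1 * e * yx.2 = bd_idem d (tagged p) by move=> p; apply: bd_factor.
have Ey (p : T) : (yx p).1 * e \in left_ideal e by apply/left_idealP; exists (yx p).1.
apply: squash.
apply: (@DualBasis _ _ #|T| (fun i => (Subvs (Ey (enum_val i)) : Ae_right))
          (fun i => Aer_form (yx (enum_val i)).2)) => v.
rewrite -(big_enum_val (fun p => (Aer_form (yx p).2 v) *: (Subvs (Ey p) : Ae_right))) /=.
apply: val_inj; rewrite -[LHS]mul1r -(bd_sum d) sig_big_dep /= mulr_suml.
rewrite (raddf_sum (vsval : Ae_right -> A)) /=.
apply: eq_bigr => p _; rewrite -yxE !mulrA -[_ * e * e]mulrA basic_idemK //.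
Qed.

(* l(a) : b e |-> a b e *)
Definition ell (a : A) (v : Ae_right) : Ae_right :=
  Subvs (Ael_act_subproof a (v : Ae_left)).
Fact ell_is_linear a : linear (ell a).
Proof. by move=> x u v; apply: val_inj; rewrite /= mulrDr mulrA. Qed.
HB.instance Definition _ a :=
  GRing.isLinear.Build eAe^c Ae_right Ae_right *:%R (ell a) (ell_is_linear a).

(* r(x) : b e |-> b e x *)
Definition rmul (x : eAe) (v : Ae_left) : Ae_left :=
  Subvs (mul_Ae_eAe_subproof v x).
Fact rmul_is_linear x : linear (rmul x).
Proof. by move=> a u v; apply: val_inj; rewrite /= mulrDl mulrA. Qed.
HB.instance Definition _ x :=
  GRing.isLinear.Build A Ae_left Ae_left *:%R (rmul x) (rmul_is_linear x).

Lemma ellM a b v : ell (a * b) v = ell a (ell b v).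
Proof. by apply: val_inj; rewrite /= mulrA. Qed.
Lemma rmulM x y v : rmul (x * y) v = rmul y (rmul x v).
Proof. by apply: val_inj; rewrite /= mulrA. Qed.

Definition slf_up_fun (psi : SLF eAe) (a : A) : K^o :=
  module_trace Ae_right_fg_projective (psi : eAe^c -> K) (ell a).

Definition slf_down_fun (phi : SLF A) (x : eAe) : K^o :=
  module_trace Ae_left_fg_projective (phi : A -> K) (rmul x).

Fact slf_up_is_linear psi : linear (slf_up_fun psi).
Proof.
move=> c a b; rewrite /slf_up_fun /module_trace /trace_of.
set D := unsquash _.
rewrite -linearP scaler_sumr -big_split; congr (psi _); apply: eq_bigr => i _ /=.
set v := db_vec D i.
have -> : ell (c *: a + b) v = (c *: (1 : eAe) : eAe^c) *: ell a v + ell b v.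
  apply: val_inj.
  transitivity (a * vsval v * (c *: vsval (1 : eAe)) + b * vsval v); last by [].
  by rewrite [LHS]/= eAe_one mulrDl -scalerAl -scalerAr -mulrA Ae_mule.
rewrite linearP; congr (_ + _).
by rewrite -[RHS]mulr1 -scalerAl scalerAr.
Qed.
Fact slf_down_is_linear phi : linear (slf_down_fun phi).
Proof.
move=> c x y; rewrite /slf_down_fun /module_trace /trace_of.
set D := unsquash _.
rewrite -linearP scaler_sumr -big_split; congr (phi _); apply: eq_bigr => i _ /=.
set v := db_vec D i.
have -> : rmul (c *: x + y) v = c%:A *: rmul x v + rmul y v.
  by apply: val_inj; rewrite /= mulrDr -scalerAr -scalerAl mul1r.
by rewrite linearP /= -[_%:A *: _]/(_%:A * _) -scalerAl mul1r.
Qed.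
HB.instance Definition _ psi :=
  GRing.isLinear.Build K A K^o *:%R (slf_up_fun psi) (slf_up_is_linear psi).
HB.instance Definition _ phi :=
  GRing.isLinear.Build K eAe K^o *:%R (slf_down_fun phi) (slf_down_is_linear phi).

Fact slf_up_symmetric psi : symmetric_fun (slf_up_fun psi).
Proof.
move=> a b; rewrite /slf_up_fun.
rewrite (_ : ell (a * b) = (fun v => ell a (ell b v)) :> (_ -> _)); last first.
  by apply: funext => v; rewrite ellM.
rewrite (_ : ell (b * a) = (fun v => ell b (ell a v)) :> (_ -> _)); last first.
  by apply: funext => v; rewrite ellM.
apply: (@module_traceC eAe^c Ae_right K (slf_hom psi : {additive eAe -> K^o})).
by move=> x y; apply: slfC.
Qed.

Fact slf_down_symmetric phi : symmetric_fun (slf_down_fun phi).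
Proof.
move=> x y; rewrite /slf_down_fun.
rewrite (_ : rmul (x * y) = (fun v => rmul y (rmul x v)) :> (_ -> _)); last first.
  by apply: funext => v; rewrite rmulM.
rewrite (_ : rmul (y * x) = (fun v => rmul x (rmul y v)) :> (_ -> _)); last first.
  by apply: funext => v; rewrite rmulM.
apply: (@module_traceC A Ae_left K (slf_hom phi : {additive A -> K^o})).
exact: slfC.
Qed.

(* psi |-> psi_{Ae_{eAe}} *)
Definition slf_up (psi : SLF eAe) : SLF A := mk_slf (slf_up_symmetric psi).

(* phi |-> phi_{_A Ae} *)
Definition slf_down (phi : SLF A) : SLF eAe := mk_slf (slf_down_symmetric phi).

End BasicAlgebra.

(* Main.v *)
From HB Require Import structures.
Require Import Defs.
From mathcomp Require Import all_boot all_algebra all_field.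
From mathcomp Require Import boolp.
Import GRing.Theory.
Local Open Scope ring_scope.

(** The bimodule Ae has the one-element dual basis {e} over A, so phi_{_A Ae}
    is the restriction of phi to eAe.  Since every e_ij A is isomorphic to
    e_i A, the idempotent e is full: 1 = sum_i y_i e x_i.  The elements y_i e
    with the forms v |-> e x_i v are a dual basis of Ae over eAe, whence
    psi_{Ae_{eAe}}(a) = psi (sum_i e x_i a y_i e).  Moving the factors y_i and
    x_i next to each other by symmetry makes both composites the identity. *)

Section BasicAlgebraTheory.
Variables (k : fieldType) (A : falgType k) (d : basic_decomp A).
Notation e := (basic_idem d).

Lemma basic_idem_left_ideal (a : A) : a * e \in left_ideal e.
Proof. by apply/left_idealP; exists a. Qed.

Definition Ae_gen (a : A) : subvs_of (left_ideal e) :=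
  Subvs (basic_idem_left_ideal a).

Lemma slf_downE (phi : SLF A) (x : eAe d) : slf_down d phi x = phi (vsval x).
Proof.
rewrite mk_slfE /= /slf_down_fun.
(* [Ae_gen 1] is e itself; v = v e makes it generate, with the inclusion as form. *)
have gen (v : Ae_left d) :
    v = \sum_(i < 1) Ael_form v *: (Ae_gen 1 : Ae_left d).
  by rewrite big_ord1; apply: val_inj; rewrite /= mul1r Ae_mule.
rewrite (@module_traceE A (Ae_left d) k
  (slf_hom phi : {additive A -> k^o}) (@slfC _ _ phi) _ (DualBasis gen)).
rewrite /trace_of /= big_ord1; congr (phi _).
have [b ->] := eAe_memP x.
by rewrite /= mul1r !mulrA basic_idemK.
Qed.

(** Each e_ij factors through e by [bd_factor], and the e_ij sum to 1. The sum runs over ordinals to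
    match [dual_basis]. *)
Lemma basic_idem_full : exists n (y x : 'I_n -> A), \sum_i y i * e * x i = 1.
Proof.
pose T : finType := {i : 'I_(bd_size d) & 'I_(bd_mult d i).+1}.
have /choice[yx yxE] : forall p : T, exists yx : A * A,
  yx.1 * e * yx.2 = bd_idem d (tagged p) by move=> p; apply: bd_factor.
exists #|T|, (fun i => (yx (enum_val i)).1), (fun i => (yx (enum_val i)).2).
rewrite -(big_enum_val (fun p => (yx p).1 * e * (yx p).2)) /=.
by rewrite -(bd_sum d) sig_big_dep; apply: eq_bigr => p _; apply: yxE.
Qed.

Lemma corner_mem (a : A) : e * a * e \in corner_aspace d.
Proof. by apply/cornerP; exists a. Qed.

Definition to_eAe (a : A) : eAe d := Subvs (corner_mem a).

(** The classically chosen dual basis may be replaced by one built from any expression of 1, by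
    [module_traceE]. *)
Lemma slf_upE n (y x : 'I_n -> A) (yx1 : \sum_i y i * e * x i = 1)
    (psi : SLF (eAe d)) (a : A) :
  slf_up psi a = \sum_i psi (to_eAe (x i * a * y i)).
Proof.
rewrite mk_slfE /= /slf_up_fun.
have gen (v : Ae_right d) :
    v = \sum_i Aer_form (x i) v *: (Ae_gen (y i) : Ae_right d).
  apply: val_inj; rewrite (raddf_sum (vsval : Ae_right d -> A)) /=.
  rewrite -[LHS]mul1r -yx1 mulr_suml; apply: eq_bigr => i _.
  by rewrite !mulrA -[_ * e * e]mulrA basic_idemK.
(* Products in the converse ring are reversed, hence the swapped arguments. *)
have psiC (u v : (eAe d)^c) : psi (u * v) = psi (v * u) by apply: (@slfC _ _ psi v u).
rewrite (@module_traceE (eAe d)^c (Ae_right d) k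
  (slf_hom psi : {additive eAe d -> k^o}) psiC _ (DualBasis gen)).
rewrite /trace_of /= (raddf_sum (slf_hom psi)); apply: eq_bigr => i _.
by congr (psi _); apply: val_inj; rewrite /= !mulrA.
Qed.

Lemma slf_downK (phi : SLF A) (a : A) : slf_up (slf_down d phi) a = phi a.
Proof.
have [n [y [x yx1]]] := basic_idem_full.
rewrite (slf_upE _ _ _ yx1) -[in RHS](mulr1 a) -yx1 mulr_sumr raddf_sum.
apply: eq_bigr => i _; rewrite slf_downE /=.
(* Two cyclic moves and e e = e: phi(e x a y e) = phi(y e x a) = phi(a y e x). *)
rewrite !mulrA -mulrA slfC !mulrA.
by rewrite -[_ * e * e]mulrA basic_idemK slfC !mulrA.
Qed.

Lemma slf_upK (psi : SLF (eAe d)) (z : eAe d) :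
  slf_down d (slf_up psi) z = psi z.
Proof.
have [n [y [x yx1]]] := basic_idem_full.
have ze : vsval z * e = vsval z.
  by have [b ->] := eAe_memP z; rewrite -mulrA basic_idemK.
have ez : e * vsval z = vsval z.
  by have [b ->] := eAe_memP z; rewrite !mulrA basic_idemK.
rewrite slf_downE (slf_upE _ _ _ yx1).
(* Symmetry is available only inside eAe, so x_i and y_i are first compressed to e x_i e and e y_i
   e; this is harmless next to z = e z e. *)
transitivity (\sum_i psi (z * (to_eAe (y i) * to_eAe (x i)))).
  apply: eq_bigr => i _; rewrite mulrA slfC.
  congr (psi _); apply: val_inj => /=.
  by rewrite !mulrA -[_ * e * vsval z]mulrA ez -[_ * vsval z * e]mulrA ze.
rewrite -raddf_sum -mulr_sumr; congr (psi _); rewrite -[RHS]mulr1; congr (_ * _).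
(* The compressed products sum to e (sum_i y_i e x_i) e = e, the unit of eAe. *)
apply: val_inj; rewrite [RHS]eAe_one (raddf_sum (vsval : eAe d -> A)) /=.
transitivity (e * 1 * e); last by rewrite mulr1 basic_idemK.
rewrite -yx1 mulr_sumr mulr_suml.
by apply: eq_bigr => i _; rewrite !mulrA -[_ * e * e]mulrA basic_idemK.
Qed.

Lemma slf_down_linear : linear (@slf_down k A d).
Proof.
move=> c f g; apply: val_inj; apply/lfunP => x.
rewrite [LHS]slf_downE /= !lfunE /= !lfunE /=.
by congr (c *: _ + _); rewrite -slf_downE mk_slfE.
Qed.

HB.instance Definition _ := GRing.isLinear.Build k (SLF A) (SLF (eAe d)) *:%R
  (@slf_down k A d) slf_down_linear.

Lemma slf_down_bij : bijective (@slf_down k A d).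
Proof.
(* Elements of [SLF] are equal when they agree pointwise, so the two composites give a two-sided
   inverse. *)
exists (@slf_up k A d) => f; apply: val_inj; apply/lfunP => a.
  exact: slf_downK.
exact: slf_upK.
Qed.

End BasicAlgebraTheory.

Theorem theorem5p6 (k : closedFieldType) (char0 : [pchar k] =i pred0)
    (A : falgType k) (d : basic_decomp A) :
  [/\ forall (phi : SLF A) (a : A), slf_up (slf_down d phi) a = phi a,
      forall (psi : SLF (eAe d)) (x : eAe d), slf_down d (slf_up psi) x = psi x
    & exists f : {linear SLF A -> SLF (eAe d)}, bijective f].
Proof.
split; [exact: slf_downK | exact: slf_upK |].
exists (@slf_down k A d : {linear _ -> _}).
exact: slf_down_bij.
Qed.
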